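(* Let $F$ and $H$ be sets of primes with $H\setminus F\neq\emptyset$, and pick $q\in H\setminus F$. Let $\alpha=1$ and, for each $n\geq 2$, let $d_{n,1}=\frac{1}{q^n}$. Then System $( * )$ is strongly centrally partition regular over $\mathbb G_H$, but is not partition regular over $\mathbb G_F$.
   Context: For a set $F$ of primes, $\mathbb G_F=\{a/b: a\in\mathbb Z,\ b\in\mathbb N,\ \text{all prime factors of } b \text{ lie in } F\}$ (a subring of $\mathbb Q$). System $( * )$ with $\alpha=1$ is the infinite system of linear equations in unknowns $y_1$, $x_{n,j}$, $z_n$ ($n\geq2$, $1\leq j\leq n$) consisting of, for every $n\geq2$, the equation $x_{n,1}+\cdots+x_{n,n}+d_{n,1}y_1=z_n$. A system is partition regular over a set $S\subseteq\mathbb R$ if, whenever $S\setminus\{0\}$ is finitely coloured, there is a solution with all variables in one colour class. For a commutative semigroup $(S,+)$ with the discrete topology, $\beta S$ is the Stone–Čech compactification, whose points are the ultrafilters on $S$. The operation extends to $\beta S$ by: $A\in p+q$ iff $\{x\in S:-x+A\in q\}\in p$, where $-x+A=\{y\in S:x+y\in A\}$; $\beta S$ is then a compact right topological semigroup with smallest two-sided ideal $K(\beta S)$, and idempotents in $K(\beta S)$ are minimal idempotents. $A\subseteq S$ is central if it belongs to some minimal idempotent. A system is strongly centrally partition regular over $S$ if whenever $C$ is a central subset of $S$, there is a solution with all variables taking values in $C$ and distinct variables taking different values. *)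

(* Defs.v *)
From HB Require Import structures.
From mathcomp Require Import all_boot all_order all_algebra.
From mathcomp Require Import boolp classical_sets filter.

Set Implicit Arguments.
Unset Strict Implicit.
Unset Printing Implicit Defensive.

Import Order.TTheory GRing.Theory Num.Theory.
Local Open Scope classical_set_scope.
Local Open Scope ring_scope.

Section StoneCech.
Variable S : addSemigroupType.
Implicit Types (A C : set S) (p q : set_system S) (I : set (set_system S)).

Definition betaS : set (set_system S) := [set p | UltraFilter p].

(* The inner set is -x + A.  The order of the two quantifiers matters: this
   operation is not commutative even though S is. *)
Definition beta_add p q : set_system S :=
  [set A | p [set x | q [set y | A (x + y)]]].

Definition beta_ideal I : Prop :=
  [/\ I `<=` betaS, I !=set0 &
      forall p q, betaS p -> I q -> I (beta_add p q) /\ I (beta_add q p)].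

(* [smallest P set0] is the intersection of all the sets satisfying P. *)
Definition K_beta : set (set_system S) := smallest beta_ideal set0.

Definition minimal_idempotent p : Prop := K_beta p /\ beta_add p p = p.

Definition central C : Prop := exists2 p, minimal_idempotent p & p C.

End StoneCech.

(* The semigroup (S, +) as a type, for S closed under addition in V. *)
Section SubSemigroup.
Variables (V : nmodType) (S : addrClosed V).

Record subsemigroup := SubSemigroup {
  subsemigroup_val : V;
  _ : (S : {pred V}) subsemigroup_val }.

HB.instance Definition _ := [isSub for subsemigroup_val].
HB.instance Definition _ := [Choice of subsemigroup by <:].
HB.instance Definition _ :=
  GRing.SubChoice_isSubNmodule.Build V _ subsemigroup (GRing.rpred0D S).

End SubSemigroup.

(* A system of equations in the unknowns V is given by its set of solutions. *)
Section PartitionRegularity.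
Variables (V : Type) (K : numFieldType).

(* Only the values of the colouring c on S \ {0} matter. *)
Definition partition_regular (S : {pred K}) (sys : set (V -> K)) : Prop :=
  forall (k : nat) (c : K -> 'I_k), exists i : 'I_k, exists2 s : V -> K,
    sys s & forall v, [/\ s v \in S, s v != 0 & c (s v) = i].

Definition strongly_centrally_partition_regular
    (S : addrClosed K) (sys : set (V -> K)) : Prop :=
  forall C : set (subsemigroup S), central C ->
    exists s : V -> subsemigroup S,
      [/\ sys (fun v => val (s v)), injective s & forall v, C (s v)].

End PartitionRegularity.

(* The unknowns y_1, x_{n,j}, z_n for n >= 2; the index j runs over 'I_n. *)
Inductive unknown :=
  | Y1
  | X (n : nat) of (2 <= n)%N & 'I_n
  | Z (n : nat) of (2 <= n)%N.

Definition system_star (K : numFieldType) (d : nat -> K) :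
    set (unknown -> K) :=
  [set s | forall (n : nat) (n_ge2 : (2 <= n)%N),
    \sum_(j < n) s (X n_ge2 j) + d n * s Y1 = s (Z n_ge2)].

Definition GG (F : set nat) : {pred rat} := fun x => `[<
  exists a : int, exists b : nat,
    [/\ (0 < b)%N,
        forall p, prime p -> (p %| b)%N -> F p &
        x = a%:~R / b%:R] >].

Lemma GG_subring (F : set nat) : subring_closed (GG F).
Proof.
have natr_neq0 b : (0 < b)%N -> b%:R != 0 :> rat by rewrite pnatr_eq0 -lt0n.
split.
- apply/asboolP; exists 1, 1%N; split=> [//|p p_prime|].
    by rewrite dvdn1 => /eqP p1; rewrite p1 in p_prime.
  by rewrite divr1.
- move=> _ _ /asboolP[a [b [b0 bF ->]]] /asboolP[a' [b' [b'0 b'F ->]]].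
  apply/asboolP; exists (a * b'%:Z - a' * b%:Z), (b * b')%N.
  split=> [|p p_prime|]; first by rewrite muln_gt0 b0.
    by rewrite Euclid_dvdM // => /orP[/bF|/b'F]; exact.
  rewrite rmorphB /= !rmorphM /= -[- (_ / _)]mulNr addf_div ?natr_neq0 //.
  by rewrite mulNr.
- move=> _ _ /asboolP[a [b [b0 bF ->]]] /asboolP[a' [b' [b'0 b'F ->]]].
  apply/asboolP; exists (a * a'), (b * b')%N.
  split=> [|p p_prime|]; first by rewrite muln_gt0 b0.
    by rewrite Euclid_dvdM // => /orP[/bF|/b'F]; exact.
  by rewrite !rmorphM mulf_div.
Qed.

HB.instance Definition _ (F : set nat) :=
  GRing.isSubringClosed.Build rat (GG F) (GG_subring F).

(* Main.v *)
(** Let p be a minimal idempotent on G = G_H, C a member of p, and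
    D = {d | -d + C in p}.  Minimality makes D syndetic, and idempotency puts D
    in p.  Call g n-solvable if x_1 + ... + x_n + g = z has solutions in C
    avoiding any prescribed finite set.
    - Every difference of elements of D is n-solvable for n >= 2, and by
      syndeticity {y | y / q^n is in D - D} belongs to p for each n.  This
      handles finitely many n.
    - Let Gam be the subgroup generated by D.  Finitely many translates e + D
      with e in Gam cover it; a common translate v of those e turns each v + e
      into a sum of m elements of C, with m fixed.  Hence all of Gam is
      n-solvable for every n >= m + 2.  Gam has finite index, so it is closed
      under division by q, and y in Gam handles the remaining n.
    Solutions for successive n are then chosen disjoint from the earlier ones.
    In the other direction, y / q^n in G_F for all n forces y = 0. *)
From HB Require Import structures.
Require Import Defs.
From mathcomp Require Import all_boot all_order all_algebra.
From mathcomp Require Import boolp classical_sets filter.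
Import Order.TTheory GRing.Theory Num.Theory.
Set Implicit Arguments.
Unset Strict Implicit.
Unset Printing Implicit Defensive.
Local Open Scope classical_set_scope.
Local Open Scope ring_scope.

(** * Ultrafilters, recurrence and syndetic return sets *)

Lemma ultra_setC_proper (T : Type) (F : set_system T) :
  ProperFilter F -> (forall A, F A \/ F (~` A)) -> UltraFilter F.
Proof.
move=> PF FC; split=> // G PG sFG; apply/seteqP; split=> // A GA.
have [//|/sFG GAc] := FC A.
by case: (@filter_not_empty _ G PG); rewrite -(setICr A); exact: filterI.
Qed.

Lemma ultra_notP (T : Type) (F : set_system T) (A : set T) :
  UltraFilter F -> ~ F A -> F (~` A).
Proof. by move=> UF nFA; have [] := in_ultra_setVsetC A UF. Qed.

Section BetaS.
Variable S : nmodType.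
Implicit Types (A C : set S) (p r u : set_system S).

Lemma beta_add_ultra p r :
  UltraFilter p -> UltraFilter r -> UltraFilter (beta_add p r).
Proof.
move=> Up Ur; apply: ultra_setC_proper; last first.
  move=> A; have [pA|npA] := EM (beta_add p r A); first by left.
  right; have : p (~` [set x | r [set y | A (x + y)]]) by exact: ultra_notP.
  by apply: (@filterS _ p) => x /ultra_notP.
split; first by move=> /(@filter_ex _ p)[x] /filter_ex[y].
split; rewrite /beta_add.
- by apply: (@filterE _ p) => x; apply: filterT.
- by move=> A B; apply: (@filterS2 _ p) => x; apply: filterS2.
- move=> A B sAB; apply: (@filterS _ p) => x.
  by apply: filterS => y; exact: sAB.
Qed.

Lemma beta_addA p r u : beta_add p (beta_add r u) = beta_add (beta_add p r) u.
Proof.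
apply/predeqP => A; rewrite /beta_add /=.
suff -> : [set x | r [set y | u [set z | A (x + (y + z))]]] =
  [set x | r [set y | u [set z | A (x + y + z)]]] by [].
apply/funext => x; congr (r _); apply/funext => y; congr (u _).
by apply/funext => z; rewrite /mkset addrA.
Qed.

Definition translation_invariant (F : set_system S) :=
  forall x A, F A -> F [set y | A (x + y)].

(* Translation-invariant filters correspond to closed left ideals of the
   Stone-Cech compactification, maximal filters to minimal ideals. *)
Lemma exists_maximal_invariant_filter :
  exists M : set_system S, [/\ ProperFilter M, translation_invariant M &
    forall N : set_system S, ProperFilter N -> translation_invariant N ->
      M `<=` N -> N `<=` M].
Proof.
pose P (F : set (set S)) := [/\ ~ F set0, setI_closed F,
  forall A B, A `<=` B -> F A -> F B & translation_invariant F].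
have [|M [[M0 MI MS MT] Mmax]] := @Zorn_bigcup (set S) P.
  move=> F sFP Ftot; split.
  - by move=> [X FX]; have [X0 _ _ _] := sFP _ FX; exact: X0.
  - move=> A B [X FX XA] [Y FY YB].
    have [sXY|sYX] := Ftot _ _ FX FY.
      exists Y => //; have [_ YI _ _] := sFP _ FY.
      by apply: YI => //; exact: sXY.
    exists X => //; have [_ XI _ _] := sFP _ FX.
    by apply: XI => //; exact: sYX.
  - move=> A B sAB [X FX XA]; exists X => //.
    by have [_ _ XS _] := sFP _ FX; apply: XS sAB XA.
  - move=> x A [X FX XA]; exists X => //.
    by have [_ _ _ XT] := sFP _ FX; apply: XT.
have maxM N : P N -> M `<=` N -> N `<=` M.
  by move=> PN sMN; apply: contrapT => nsNM; apply: (Mmax N).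
(* [P] does not ask for [setT], because the union of the empty chain is empty. Maximality recovers
   it: an empty [M] would lie below [[set setT]]. *)
have MTT : M setT.
  have [[A MA]|M_eq0] := EM (M !=set0); first exact: MS MA.
  apply: (maxM [set setT]) => //; last by move=> A MA; case: M_eq0; exists A.
  split.
  - by move=> /seteqP[_ /(_ 0 I)].
  - by move=> A B -> ->; rewrite setTI.
  - move=> A B sAB /= TA; apply/seteqP; split=> // x _.
    by apply: sAB; rewrite TA.
  - by move=> x A /= ->.
exists M; split=> // N PN NT sMN; apply: maxM sMN; split=> //.
- by move=> A B; exact: (@filterI _ N).
- by move=> A B; exact: (@filterS _ N).
Qed.

(* u lies in the closure of the orbit S + (r + u) for every r, i.e. the left
   ideal generated by u is minimal; in this form the property is plainly stable
   under adding ultrafilters on both sides. *)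
Definition recurrent u := forall r A,
  UltraFilter r -> u A -> exists x, beta_add r u [set y | A (x + y)].

(** Any [u] above a maximal invariant filter [M] works. If [r + u] contained no translate of [A],
    the sets all of whose translates lie in [r + u] would form an invariant filter above [M], hence
    equal to [M], and the complement of [A] would lie in [u]. *)
Lemma exists_recurrent : exists2 u, UltraFilter u & recurrent u.
Proof.
have [M [PM MT Mmax]] := exists_maximal_invariant_filter.
have [u [Uu sMu]] := ultraFilterLemma PM.
exists u => // r A Ur uA; apply: contrapT => /forallNP nA.
have Uru := beta_add_ultra Ur Uu.
pose N : set_system S :=
  [set B | forall x, beta_add r u [set y | B (x + y)]].
have PN : ProperFilter N.
  split; first by move=> /(_ 0) /filter_not_empty.
  split.
  - by move=> x; apply: filterE.
  - by move=> B B' NB NB' x; apply: filterS2 (NB x) (NB' x).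
  - by move=> B B' sBB' NB x; apply: filterS (NB x) => y; exact: sBB'.
have NT : translation_invariant N.
  by move=> x B NB z; have := NB (x + z); under eq_fun do rewrite -addrA.
have sMN : M `<=` N.
  move=> B MB x; apply: (@filterE _ r) => y; apply: sMu => /=.
  by apply: (MT y [set z | B (x + z)]); apply: MT.
have uAc : u (~` A).
  by apply/sMu/(Mmax N) => // x; apply: ultra_notP (nA x).
by case: (@filter_not_empty _ u _); rewrite -(setICr A); exact: filterI.
Qed.

(** The recurrent ultrafilters form a two-sided ideal, so they include the intersection of all
    ideals. *)
Lemma K_beta_recurrent p : K_beta p -> UltraFilter p /\ recurrent p.
Proof.
move=> Kp; suff: [set u | UltraFilter u /\ recurrent u] p by [].
apply: smallest_sub Kp => //; split.
- by move=> u [].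
- by have [u Uu recu] := exists_recurrent; exists u.
- rewrite /betaS /= => r u Ur [Uu recu].
  split; split; do ?exact: beta_add_ultra.
  + move=> r' A Ur' /(@filter_ex _ r)[y uA].
    have [x xA] := recu _ _ (beta_add_ultra Ur' Ur) uA.
    exists (y + x); rewrite beta_addA.
    by under eq_fun do rewrite -addrA.
  + move=> r' A Ur' urA; have [x xA] := recu _ _ Ur' urA.
    exists x; rewrite beta_addA.
    by move: xA; rewrite {1}/beta_add/=; under eq_fun do
      under [X in u X]eq_fun do under eq_fun do rewrite -addrA.
Qed.

Definition return_set p C : set S := [set x | p [set y | C (x + y)]].

(** If every finite [E] failed, some ultrafilter [r] would contain all the sets [B E]; recurrence of
    [p] against [r] gives one [e] for which [r]-many [x] lie outside [B [:: e]]. *)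
Lemma return_set_syndetic p C : UltraFilter p -> recurrent p -> p C ->
  exists E : seq S, forall x, exists2 e, e \in E & return_set p C (x + e).
Proof.
move=> Up recp pC; apply: contrapT => /forallNP nE.
pose B (E : seq S) := [set x | forall e, e \in E -> ~ return_set p C (x + e)].
have PB : ProperFilter (filter_from setT B).
  apply: filter_from_proper.
    apply: filter_from_filter; first by exists [::].
    move=> E E' _ _; exists (E ++ E') => // x xE.
    by split=> e eE; apply: xE; rewrite mem_cat eE ?orbT.
  move=> E _; have /existsNP[x xE] := nE E.
  by exists x => e eE xe; apply: xE; exists e.
have [r [Ur sBr]] := ultraFilterLemma PB.
have [e] := recp _ _ Ur pC; rewrite /beta_add /= => re.
have /(filterI re) : r (B [:: e]) by apply: sBr; exists [:: e].
move=> /filter_ex[x [/= xe]] /(_ e); rewrite mem_head => /(_ isT); apply.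
by rewrite /return_set/=; move: xe; under eq_fun do rewrite addrCA addrA.
Qed.
End BetaS.

Lemma infinite_pigeonhole (T : eqType) (E : seq T) (g : nat -> T) :
  (forall i, g i \in E) -> exists i j, (i < j)%N /\ g i = g j.
Proof.
move=> gE; pose s := mkseq g (size E).+1.
have /(uniqPn (g 0%N))[i [j [ltij]]] : ~~ uniq s.
  apply/negP => uniq_s; have := @uniq_leq_size _ s E uniq_s.
  rewrite size_mkseq ltnn => s_le.
  by apply: notF; apply: s_le => _ /mapP[i _ ->].
rewrite size_mkseq => ltj; rewrite !nth_mkseq ?(ltn_trans ltij) // => eqg.
by exists i, j.
Qed.

Lemma ultra_seq_bigcup (T : Type) (I : eqType) (p : set_system T) (E : seq I)
    (P : I -> set T) : UltraFilter p ->
  p [set x | exists2 e, e \in E & P e x] -> exists2 e, e \in E & p (P e).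
Proof.
move=> Up; elim: E => [|e E IH].
  by move=> /filter_ex[x [e]].
have [pe|/ultra_notP npe] := EM (p (P e)); first by exists e; rewrite ?mem_head.
move=> pE; have [|e' e'E pe'] := IH.
  apply: filterS2 npe pE => x /= nPx [e']; rewrite inE => /predU1P[->//|].
  by exists e'.
by exists e' => //; rewrite inE e'E orbT.
Qed.

(** * Sums of distinct elements and generated subgroups *)

Section DistinctSums.
Variable G : zmodType.
Implicit Types (C D : set G) (B E : seq G) (g d e v w x y z : G).

Definition distinct_sum C B n g := exists xs : seq G,
  [/\ size xs = n, uniq xs, forall x, x \in xs -> C x /\ x \notin B &
      \sum_(x <- xs) x = g].

(* Solvability of x_1 + ... + x_n + g = z in C, with room to spare: the
   values can be kept away from any finite set. *)
Definition amply_solvable C n g := forall B, exists z (xs : seq G),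
  [/\ size xs = n, uniq (z :: xs),
      forall x, x \in z :: xs -> C x /\ x \notin B &
      \sum_(x <- xs) x + g = z].

Lemma distinct_sum_subset C B B' n g : {subset B <= B'} ->
  distinct_sum C B' n g -> distinct_sum C B n g.
Proof.
move=> sBB' [xs [szxs uxs CxsB sumxs]]; exists xs; split=> // x /CxsB[Cx].
by move=> xB'; split=> //; apply: contra xB'; exact: sBB'.
Qed.

Lemma distinct_sum_extend C B n g : distinct_sum C B n g ->
  exists B', forall n' g', distinct_sum C B' n' g' ->
    distinct_sum C B (n + n') (g + g').
Proof.
move=> [xs [szxs uxs CxsB sumxs]]; exists (B ++ xs) => n' g'.
move=> [ys [szys uys CysB sumys]]; exists (xs ++ ys); split.
- by rewrite size_cat szxs szys.
- rewrite cat_uniq uxs uys andbT; apply/hasPn => y /CysB[_].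
  by rewrite mem_cat negb_or => /andP[].
- move=> x; rewrite mem_cat => /orP[/CxsB//|/CysB[Cx]].
  by rewrite mem_cat negb_or => /andP[].
- by rewrite big_cat sumxs sumys.
Qed.

Lemma distinct_sum_extend_seq C B n v E :
  (forall e, e \in E -> distinct_sum C B n (v + e)) ->
  exists B', forall e n' g', e \in E -> distinct_sum C B' n' g' ->
    distinct_sum C B (n + n') (v + e + g').
Proof.
elim: E => [|e E IH] vE; first by exists [::].
have [|B1 B1P] := IH; first by move=> e' e'E; apply: vE; rewrite inE e'E orbT.
have [B2 B2P] := distinct_sum_extend (vE e (mem_head _ _)).
exists (B1 ++ B2) => e' n' g'; rewrite inE => /predU1P[->|e'E] Cg'.
  apply: B2P; apply: distinct_sum_subset Cg' => x.
  by rewrite mem_cat orbC => ->.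
by apply: B1P => //; apply: distinct_sum_subset Cg' => x; rewrite mem_cat => ->.
Qed.

Lemma amply_solvable_add C n g v B k : distinct_sum C B k v ->
  amply_solvable C n (v + g) -> exists z (xs : seq G),
  [/\ size xs = (k + n)%N, uniq (z :: xs),
      forall x, x \in z :: xs -> C x /\ x \notin B &
      \sum_(x <- xs) x + g = z].
Proof.
move=> [xs [szxs uxs CxsB sumxs]] /(_ (B ++ xs))[z [ys [szys uzys CysB zE]]].
have CysB' x : x \in z :: ys -> [/\ C x, x \notin B & x \notin xs].
  by move=> /CysB[Cx]; rewrite mem_cat negb_or => /andP[].
exists z, (xs ++ ys); split.
- by rewrite size_cat szxs szys.
- have -> : uniq (z :: xs ++ ys) = uniq (xs ++ z :: ys).
    by apply: perm_uniq; rewrite perm_sym -cat1s perm_catCA.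
  by rewrite cat_uniq uxs uzys andbT; apply/hasPn => y /CysB'[].
- move=> x; rewrite inE mem_cat orbCA -in_cons => /orP[/CxsB//|/CysB'[]//].
- by rewrite big_cat /= sumxs -zE addrCA addrA.
Qed.

(** Closure under differences is enough: sums and negatives follow once [0] is in [D]. *)
Inductive generated_subgroup D : set G :=
  | generated_in d of D d : generated_subgroup D d
  | generatedB x y of generated_subgroup D x & generated_subgroup D y :
      generated_subgroup D (x - y).

Section Generated.
Variable D : set G.
Hypothesis D0 : D 0.

Lemma generated0 : generated_subgroup D 0.
Proof. exact: generated_in. Qed.

Lemma generatedD x y : generated_subgroup D x -> generated_subgroup D y ->
  generated_subgroup D (x + y).
Proof.
move=> Dx Dy; rewrite -[y]opprK -[- y]sub0r.
by do 2![apply: generatedB => //]; exact: generated0.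
Qed.

Lemma generatedMn x n : generated_subgroup D x -> generated_subgroup D (x *+ n).
Proof.
move=> Dx; elim: n => [|n IH]; first by rewrite mulr0n; exact: generated0.
by rewrite mulrS; exact: generatedD.
Qed.

End Generated.

(** * Solvability from a recurrent idempotent *)

Section IdempotentCombinatorics.
Variables (p : set_system G) (C : set G) (f : nat -> G).
Context {Up : UltraFilter p}.
Hypotheses (recp : recurrent p) (idp : beta_add p p = p) (pC : p C).
Hypothesis (f_inj : injective f).

Let D := return_set p C.
Let Gam := generated_subgroup D.

Lemma return_set_beta_add A : p A -> p [set x | p [set y | A (x + y)]].
Proof. by rewrite -{1}idp. Qed.

Lemma return_set_translate d : D d -> p [set x | D (d + x)].
Proof.
move=> /return_set_beta_add; apply: filterS => x; apply: filterS => y.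
by rewrite /= addrA.
Qed.

Lemma return_set0 : D 0.
Proof.
by rewrite /D /return_set /=; apply: filterS pC => x; rewrite /= add0r.
Qed.

(** Finitely many shifts bring every [h i] into the return set; two indices share a shift, which
    cancels in the difference. *)
Lemma recurrence_difference (A : set G) (h : nat -> G) : p A ->
  exists i j d d', [/\ (i < j)%N, return_set p A d, return_set p A d' &
    h j - h i = d' - d].
Proof.
move=> /(return_set_syndetic Up recp)[E EP].
have /choice[k kP] : forall x, exists e, e \in E /\ return_set p A (x + e).
  by move=> x; have [e eE xe] := EP x; exists e.
have [|i [j [ltij eqk]]] := @infinite_pigeonhole _ E (k \o h).
  by move=> i; have [] := kP (h i).
exists i, j, (h i + k (h i)), (h j + k (h j)); split=> //.
- by have [] := kP (h i).
- by have [] := kP (h j).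
- by rewrite -[k (h j)]eqk /= opprD addrACA subrr addr0.
Qed.

(** The return set of a singleton in [p] is contained in [{0}], which would force two values of the
    injective [f] to coincide. *)
Lemma nonprincipal a : p [set~ a].
Proof.
apply: ultra_notP => pa.
have ra0 d : return_set p [set a] d -> d = 0.
  move=> /(filterI pa)/filter_ex[x /= [->]] /eqP.
  by rewrite -subr_eq0 addrK => /eqP.
have [i [j [d [d' [ltij /ra0-> /ra0->]]]]] := recurrence_difference f pa.
rewrite subrr => /eqP; rewrite subr_eq0 => /eqP/f_inj eqij.
by rewrite eqij ltnn in ltij.
Qed.

Lemma avoid_finite B d : p [set x | d + x \notin B].
Proof.
elim: B => [|b B IH]; first exact: filterE.
apply: filterS2 (nonprincipal (b - d)) IH => x /= xbd xB.
rewrite inE negb_or xB andbT; apply/eqP => xb; apply: xbd.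
by rewrite -xb addrC addKr.
Qed.

Lemma pick_avoiding (A : set G) B : p A -> exists2 x, A x & C x /\ x \notin B.
Proof.
move=> pA; have [x [[Ax Cx]]] :=
  filter_ex (filterI (filterI pA pC) (avoid_finite B 0)).
by rewrite /= add0r => xB; exists x.
Qed.

Lemma amply_solvableS n g :
  p [set x | amply_solvable C n (x + g)] -> amply_solvable C n.+1 g.
Proof.
move=> pg B; have [x xg [Cx xB]] := pick_avoiding B pg.
rewrite -add1n; apply: amply_solvable_add xg.
exists [:: x]; split=> //; last by rewrite big_seq1.
by move=> y; rewrite inE => /eqP->.
Qed.

(** One summand: [d + x] and [d' + x] both lie in [C] for [p]-many [x]. Each further summand [x]
    replaces [d'] by [d' + x], again in [D]. *)
Lemma amply_solvable_neq d d' n : D d -> D d' -> d != d' ->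
  amply_solvable C n.+1 (d' - d).
Proof.
move=> Dd; elim: n d' => [|n IH] d' Dd' neq_dd'.
  move=> B; have [x [[Cdx Cd'x] [dxB d'xB]]] := filter_ex (filterI
    (filterI Dd Dd') (filterI (avoid_finite B d) (avoid_finite B d'))).
  exists (d' + x), [:: d + x]; split=> //.
  - by rewrite /= inE andbT (inj_eq (addIr x)) eq_sym.
  - by move=> y; rewrite !inE => /orP[]/eqP->.
  - by rewrite big_seq1 addrCA [d + x]addrC addrK.
apply: amply_solvableS.
apply: filterS2 (return_set_translate Dd') (nonprincipal (d - d')) => x Dx xd.
rewrite /= addrA [x + d']addrC; apply: IH => //; apply/eqP => dE; apply: xd.
by rewrite /= dE addrAC subrr add0r.
Qed.

Lemma amply_solvable_difference d d' n : D d -> D d' ->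
  amply_solvable C n.+2 (d' - d).
Proof.
(* The extra summand [x] separates [d' + x] from [d], which covers the case [d = d']. *)
move=> Dd Dd'; apply: amply_solvableS.
apply: filterS2 (return_set_translate Dd') (nonprincipal (d - d')) => x Dx xd.
rewrite /= addrA [x + d']addrC; apply: amply_solvable_neq => //.
by apply/eqP => dE; apply: xd; rewrite /= dE addrAC subrr add0r.
Qed.

Lemma pGam : p Gam.
Proof.
by apply: filterS (return_set_beta_add pC) => x; exact: generated_in.
Qed.

(** The number [n] of summands depends on [g] only, while [w] may vary with [B]. *)
Lemma generated_shift g : Gam g -> exists n, forall B,
  exists2 w, Gam w & distinct_sum C B n w /\ distinct_sum C B n (w + g).
Proof.
have sum1 x B : C x -> x \notin B -> distinct_sum C B 1 x.
  move=> Cx xB; exists [:: x]; split=> //; last by rewrite big_seq1.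
  by move=> y; rewrite inE => /eqP->.
elim=> {g} [d Dd|x y Gx [n nP] Gy [m mP]].
  exists 1%N => B; have [c [[Cdc dcB] Gc] [Cc cB]] := pick_avoiding B
    (filterI (filterI Dd (avoid_finite B d)) pGam).
  by exists c => //; split; [|rewrite addrC]; exact: sum1.
exists (n + m)%N => B; have [w Gw [Cw Cwx]] := nP B.
have [B1 B1P] := distinct_sum_extend Cw.
have [B2 B2P] := distinct_sum_extend Cwx.
have [w' Gw' [Cw' Cw'y]] := mP (B1 ++ B2).
(* Adding [x - y] turns this into [(w + x) + w'], again a sum of [n + m] elements. *)
exists (w + (w' + y)).
  exact: (generatedD return_set0 Gw (generatedD return_set0 Gw' Gy)).
split.
  by apply: B1P; apply: distinct_sum_subset Cw'y => z; rewrite mem_cat => ->.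
have -> : w + (w' + y) + (x - y) = w + x + w'.
  by rewrite !addrA addrAC addrK addrAC.
by apply: B2P; apply: distinct_sum_subset Cw' => z; rewrite mem_cat orbC => ->.
Qed.

(** The shifts for the single elements are added up. Including [0] makes [v] itself a sum of [n]
    elements, as the induction requires. *)
Lemma generated_shift_seq E : (forall e, e \in E -> Gam e) ->
  exists n, forall B, exists2 v, Gam v &
    forall e, e \in 0 :: E -> distinct_sum C B n (v + e).
Proof.
elim: E => [|e E IH] EG.
  exists 0%N => B; exists 0; first exact/generated0/return_set0.
  by move=> e; rewrite inE => /eqP->; exists [::]; rewrite big_nil addr0.
have [|n nP] := IH; first by move=> e' e'E; apply: EG; rewrite inE e'E orbT.
have [m mP] := generated_shift (EG e (mem_head _ _)).
exists (n + m)%N => B; have [v Gv Cv] := nP B.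
have [B' B'P] := distinct_sum_extend_seq Cv.
have [w Gw [Cw Cwe]] := mP B'.
exists (v + w); first exact: (generatedD return_set0).
move=> e'; rewrite !inE orbCA => /predU1P[->|e'E].
  by rewrite -addrA -[v]addr0; apply: B'P => //; exact: mem_head.
by rewrite addrAC; apply: B'P.
Qed.

Lemma generated_amply_solvable : exists m, forall n g,
  (m <= n)%N -> Gam g -> amply_solvable C n g.
Proof.
have [E EP] := return_set_syndetic Up recp pC.
have [|m mP] := @generated_shift_seq [seq e <- E | `[< Gam e >]].
  by move=> e; rewrite mem_filter => /andP[/asboolP].
(* [v + e] uses up [m] summands; the remainder [v + g + e] is the difference of an element of [D]
   and [0], which takes any number of summands from two on. *)
exists (m + 2)%N => n g len Gg B; have [v Gv Cv] := mP B.
have [e eE De] := EP (v + g).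
have Ge : Gam e.
  rewrite -[e](addKr (v + g)) addrC; apply: generatedB.
    exact: generated_in.
  exact: (generatedD return_set0).
rewrite -(subnKC len) -addnA; apply: (@amply_solvable_add _ _ _ (v + e)).
  by apply: Cv; rewrite inE mem_filter eE asboolT ?orbT.
rewrite addrAC -[X in amply_solvable _ _ X]subr0.
exact: (amply_solvable_difference _ return_set0).
Qed.

(** One [e] puts [psi y + e] in [D] for [p]-many [y]. By idempotency, [p]-many [x] admit a [y] such
    that both [y] and [x + y] qualify; subtracting leaves [psi x]. *)
Lemma endomorphism_difference (psi : G -> G) : {morph psi : x y / x + y} ->
  p [set y | exists d d', [/\ D d, D d' & psi y = d' - d]].
Proof.
move=> psiD; have [E EP] := return_set_syndetic Up recp pC.
have [|e eE pe] := @ultra_seq_bigcup _ _ p E (fun e => [set y | D (psi y + e)]).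
  by apply: filterE => y; exact: EP.
apply: filterS (return_set_beta_add pe) => x.
move=> /(filterI pe)/filter_ex[y [/= Dy Dxy]].
exists (psi y + e), (psi (x + y) + e); split=> //.
by rewrite opprD addrACA subrr addr0 psiD addrK.
Qed.

(** * Division by [q] and the choice of the parameter *)

Variables (q : nat) (phi : {additive G -> G}).
Hypothesis phiK : forall x, phi x *+ q = x.

Lemma iterMnK n x : iter n phi x *+ q ^ n = x.
Proof. by elim: n => //= n IH; rewrite expnS mulrnA phiK. Qed.

(* For t = x / q, pigeonhole puts t / q^j - t / q^i in Gam for some i < j;
   multiply it by q^j. *)
Lemma generated_divide x : Gam x -> Gam (phi x).
Proof.
move=> Gx.
have [i [j [d [d' [ltij Dd Dd' hE]]]]] :=
  recurrence_difference (fun n => iter n phi (phi x)) pC.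
have -> : phi x = (d' - d) *+ q ^ j + x *+ q ^ (j - i.+1).
  have qE : (q ^ j = q ^ i * (q * q ^ (j - i.+1)))%N.
    by rewrite -expnS subnSK // -expnD subnKC // ltnW.
  rewrite -hE mulrnBl iterMnK [in X in _ - X]qE mulrnA iterMnK.
  by rewrite mulrnA phiK subrK.
apply: (generatedD return_set0); apply: (generatedMn return_set0) => //.
by apply: generatedB; exact: generated_in.
Qed.

Lemma generated_iter_divide n x : Gam x -> Gam (iter n phi x).
Proof. by move=> Gx; elim: n => //= n; exact: generated_divide. Qed.

Lemma exists_ample_parameter : exists2 y, C y &
  forall n, (2 <= n)%N -> amply_solvable C n (iter n phi y).
Proof.
have [m mP] := generated_amply_solvable.
have small k : p [set y | forall n, (2 <= n)%N -> (n < k)%N ->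
    amply_solvable C n (iter n phi y)].
  elim: k => [|k IH]; first exact: filterE.
  have iterD : {morph iter k phi : x y / x + y}.
    by move=> x y; elim: k {IH} => //= k ->; rewrite raddfD.
  apply: filterS2 IH (endomorphism_difference iterD) => y yP.
  move=> [d [d' [Dd Dd' yE]]] n n2.
  rewrite ltnS leq_eqVlt => /predU1P[nk|]; last exact: yP.
  by rewrite nk yE -nk -(subnKC n2) add2n; exact: amply_solvable_difference.
have [y ysmall [Cy _]] := pick_avoiding [::] (filterI (small m) pGam).
exists y => // n n2; have [lenm|ltnm] := leqP m n.
  by apply: mP => //; apply: generated_iter_divide; case: ysmall.
by case: ysmall => + _; exact.
Qed.

End IdempotentCombinatorics.
End DistinctSums.

(** * Assembling an injective solution *)

HB.instance Definition _ (V : zmodType) (S : zmodClosed V) :=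
  [SubNmodule_isSubZmodule of subsemigroup S by <:].

(* The nth block of values, z_n followed by the x_{n,j}, avoids y and all
   earlier blocks. *)
Lemma solution_of_amply_solvable (G : zmodType) (C : set G) (g : nat -> G)
    (y : G) :
  C y -> (forall n, (2 <= n)%N -> amply_solvable C n (g n)) ->
  exists s : unknown -> G, [/\ injective s, forall v, C (s v), s Y1 = y &
    forall n (n_ge2 : (2 <= n)%N),
      \sum_(j < n) s (X n_ge2 j) + g n = s (Z n_ge2)].
Proof.
move=> Cy gP.
have /choice[F FP] : forall nB : nat * seq G, exists zxs : G * seq G,
    (2 <= nB.1)%N -> [/\ size zxs.2 = nB.1, uniq (zxs.1 :: zxs.2),
      forall x, x \in zxs.1 :: zxs.2 -> C x /\ x \notin nB.2 &
      \sum_(x <- zxs.2) x + g nB.1 = zxs.1].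
  (* For [n < 2] there is no equation, and the pair is a dummy. *)
  move=> [n B]; have [n2|] := leqP 2 n; last by exists (0, [::]).
  by have [z [xs zxsP]] := gP n n2 B; exists (z, xs).
pose block (zxs : G * seq G) := zxs.1 :: zxs.2.
pose used := fix used n := if n is m.+1 then block (F (m, used m)) ++ used m
  else [:: y].
pose L n := block (F (n, used n)).
have LP n (n2 : (2 <= n)%N) := FP (n, used n) n2.
have sizeL n : (2 <= n)%N -> size (L n) = n.+1 by move=> /LP[/= ->].
have used_y n : y \in used n.
  by elim: n => [|n IH]; rewrite ?mem_head // mem_cat IH orbT.
have used_L m n x : (m < n)%N -> x \in L m -> x \in used n.
  elim: n => // n IH.
  rewrite ltnS leq_eqVlt mem_cat => /predU1P[-> ->//|ltmn xL].
  by rewrite IH ?orbT.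
have L_fresh n x : (2 <= n)%N -> x \in L n -> x \notin used n.
  by move=> /LP[_ _ /(_ x) + _] => /[apply] -[].
have L_mem n i : (2 <= n)%N -> (i <= n)%N -> nth 0 (L n) i \in L n.
  by move=> n2 lein; rewrite mem_nth ?sizeL.
have L_inj m n i j : (2 <= m)%N -> (2 <= n)%N -> (i <= m)%N -> (j <= n)%N ->
    nth 0 (L m) i = nth 0 (L n) j -> m = n /\ i = j.
  move=> m2 n2 leim lejn eqL; have [ltmn|ltnm|eqmn] := ltngtP m n.
  - case/negP: (L_fresh _ _ n2 (L_mem _ _ n2 lejn)).
    by rewrite -eqL; exact/(used_L m)/L_mem.
  - case/negP: (L_fresh _ _ m2 (L_mem _ _ m2 leim)).
    by rewrite eqL; exact/(used_L n)/L_mem.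
  - split=> //; apply/eqP; move: eqL leim; rewrite eqmn => /eqP + lein.
    by rewrite nth_uniq ?sizeL //; have [] := LP n n2.
have L_neq_y n i : (2 <= n)%N -> (i <= n)%N -> y <> nth 0 (L n) i.
  move=> n2 lein yE; have := L_fresh _ _ n2 (L_mem _ _ n2 lein).
  by rewrite -yE used_y.
pose s v := match v with
  | Y1 => y
  | X n _ j => nth 0 (L n) j.+1
  | Z n _ => nth 0 (L n) 0
  end.
exists s; split=> //.
- move=> [|m m2 i|m m2] [|n n2 j|n n2] //= eqs.
  + by case: (L_neq_y _ _ n2 (ltn_ord j)).
  + by case: (L_neq_y _ _ n2 (leq0n n)).
  + by case: (L_neq_y _ _ m2 (ltn_ord i)).
  + have [eqmn [eqij]] := L_inj _ _ _ _ m2 n2 (ltn_ord i) (ltn_ord j) eqs.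
    move: i eqij {eqs}; move: m2; rewrite eqmn => m2 i eqij.
    by rewrite (bool_irrelevance m2 n2); congr X; exact: val_inj.
  + by have [] := L_inj _ _ _ _ m2 n2 (ltn_ord i) (leq0n n) eqs.
  + by case: (L_neq_y _ _ m2 (leq0n m)).
  + by have [] := L_inj _ _ _ _ m2 n2 (leq0n m) (ltn_ord j) eqs.
  + have [eqmn _] := L_inj _ _ _ _ m2 n2 (leq0n m) (leq0n n) eqs.
    by move: m2 {eqs}; rewrite eqmn => m2; rewrite (bool_irrelevance m2 n2).
- have CL n x : (2 <= n)%N -> x \in L n -> C x.
    by move=> /LP[_ _ /(_ x) + _] => /[apply] -[].
  move=> [|n n2 j|n n2] //.
    exact: (CL n _ n2 (L_mem n j.+1 n2 (ltn_ord j))).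
  exact: (CL n _ n2 (L_mem n 0%N n2 (leq0n n))).
- move=> n n2; have [/= szL _ _ <-] := LP n n2; congr (_ + _).
  by rewrite (big_nth 0) szL big_mkord.
Qed.

(** * Arithmetic of [GG] and the two halves of the theorem *)

Lemma GG_divide (H : set nat) (q : nat) (x : rat) :
  prime q -> H q -> x \in GG H -> x / q%:R \in GG H.
Proof.
move=> q_pr Hq /asboolP[a [b [b0 bH ->]]]; apply/asboolP.
exists a, (b * q)%N; split; first by rewrite muln_gt0 b0 prime_gt0.
  move=> p p_pr; rewrite Euclid_dvdM // => /orP[pb|]; first exact: bH.
  by rewrite dvdn_prime2 // => /eqP->.
by rewrite natrM invfM mulrA.
Qed.

(** Clearing denominators gives [numq x * b = a * q ^ n * denq x], and [b] is coprime to [q ^ n]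
    because its prime factors lie in [F]. *)
Lemma GG_dividing_power (F : set nat) (q n : nat) (x : rat) :
  prime q -> ~ F q -> x / q%:R ^+ n \in GG F -> (q ^ n %| `|numq x|)%N.
Proof.
move=> q_pr nFq /asboolP[a [b [b0 bF xE]]].
have q0 : q%:R != 0 :> rat by rewrite pnatr_eq0 -lt0n prime_gt0.
have b0R : b%:R != 0 :> rat by rewrite pnatr_eq0 -lt0n.
have cqb : coprime (q ^ n) b.
  apply: coprimeXl; rewrite prime_coprime //; apply/negP => /(bF q q_pr).
  exact: nFq.
have eqn : (numq x * b%:Z = a * (q ^ n)%N%:Z * denq x)%R.
  apply: (@intr_inj rat); rewrite !rmorphM /=.
  have -> : a%:~R = x / q%:R ^+ n * b%:R :> rat by rewrite xE divfK.
  rewrite numqE -!pmulrn natrX [_ * b%:R in RHS]mulrAC.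
  by rewrite divfK ?expf_neq0 // mulrAC.
rewrite -(Gauss_dvdl _ cqb) -[b]/`|b%:Z|%N -abszM eqn !abszM /= mulnAC.
exact: dvdn_mull.
Qed.

Lemma strongly_central_system_star (H : set nat) (q : nat) :
  prime q -> H q -> strongly_centrally_partition_regular (GG H)
    (system_star (fun n => 1 / q%:R ^+ n : rat)).
Proof.
move=> q_pr Hq C [p [/K_beta_recurrent[Up recp] idp] pC].
have q0 : q%:R != 0 :> rat by rewrite pnatr_eq0 -lt0n prime_gt0.
pose G := subsemigroup (GG H).
have valG (x : G) : val x \in GG H by case: x.
(* The natural numbers serve as the injective sequence that makes [p] nonprincipal. *)
pose f n : G := @Defs.SubSemigroup _ (GG H) _ (rpred_nat (GG H) n).
have f_inj : injective f.
  by move=> m n /(congr1 val)/eqP; rewrite /= eqr_nat => /eqP.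
pose phi (x : G) : G :=
  @Defs.SubSemigroup _ (GG H) _ (GG_divide q_pr Hq (valG x)).
have phiB : zmod_morphism phi.
  by move=> x y; apply: val_inj; rewrite /= mulrBl.
pose phiM := GRing.isZmodMorphism.Build G G phi phiB.
pose phiA : {additive G -> G} := HB.pack phi phiM.
have phiK x : phiA x *+ q = x.
  by apply: val_inj; rewrite raddfMn /= -[LHS]mulr_natr divfK.
have val_iter n (y : G) : val (iter n phiA y) = 1 / q%:R ^+ n * val y.
  elim: n => [|n IH]; first by rewrite expr0 divr1 mul1r.
  by rewrite iterS /= IH exprS invfM; rewrite !mul1r mulrAC [_ * q%:R^-1]mulrC.
have [y Cy yP] := exists_ample_parameter recp idp pC f_inj phiK.
have [s [s_inj Cs sY1 sP]] := solution_of_amply_solvable Cy yP.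
exists s; split=> // n n2.
by rewrite -sP raddfD raddf_sum /= val_iter sY1.
Qed.

Lemma not_partition_regular_system_star (F : set nat) (q : nat) :
  prime q -> ~ F q -> ~ partition_regular (GG F)
    (system_star (fun n => 1 / q%:R ^+ n : rat)).
Proof.
(* A single colour suffices: no solution in [GG F] has all its values nonzero. *)
move=> q_pr nFq /(_ 1%N (fun=> ord0))[i [s sP sGG]].
have sF v : s v \in GG F by have [] := sGG v.
have y0 : s Y1 != 0 by have [] := sGG Y1.
have div_y n : (2 <= n)%N -> (q ^ n %| `|numq (s Y1)|)%N.
  move=> n2; apply: (@GG_dividing_power F) => //.
  have <- : s (Z n2) - \sum_(j < n) s (X n2 j) = s Y1 / q%:R ^+ n.
    by rewrite -(sP n n2) addrAC subrr add0r mul1r mulrC.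
  by rewrite rpredB ?rpred_sum.
(* Large enough for both [2 <= n] and [q ^ n] to exceed the numerator. *)
pose n := (`|numq (s Y1)|).+2%N.
have := dvdn_leq _ (div_y n isT); rewrite absz_gt0 numq_eq0 => /(_ y0).
rewrite leqNgt (leq_trans _ (ltnW (ltn_expl n (prime_gt1 q_pr)))) //.
Qed.

Theorem theorem4p3 (F H : set nat)
    (F_primes : forall p : nat, F p -> prime p)
    (H_primes : forall p : nat, H p -> prime p)
    (q : nat) (qHF : (H `\` F) q) :
  let d : nat -> rat := fun n => 1 / q%:R ^+ n in
  strongly_centrally_partition_regular (GG H) (system_star d) /\
  ~ partition_regular (GG F) (system_star d).
Proof.
case: qHF => Hq nFq; have q_pr := H_primes q Hq.
by split; [exact: strongly_central_system_star |
           exact: not_partition_regular_system_star].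
Qed.
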